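(* Let $V$ be a real vector space of dimension $n$ and let $\phi\in\mathfrak{gl}(V)$ be nonderogatory, with $p$ distinct real eigenvalues $\lambda_j$ of multiplicities $k_j$, $j=1,\dots,p$, and $2q$ distinct complex (nonreal) eigenvalues $z_l,\bar z_l$ of multiplicities $m_l$, $l=1,\dots,q$, where $n=k_1+\dots+k_p+2(m_1+\dots+m_q)$. Then the Lie algebra $\mathcal G_\phi:=\mathbb R[\phi]\ltimes V$ is isomorphic to the direct sum of the Lie algebras $$\mathfrak D_0^{k_1},\dots,\mathfrak D_0^{k_p},\ \mathfrak D_{0,1}^{2m_1},\dots,\mathfrak D_{0,1}^{2m_q}.$$ In particular: (a) if $p=n$, then $\mathcal G_\phi$ is isomorphic to the direct sum of $n$ copies of $\mathfrak{aff}(\mathbb R)$; (b) if $p=1$ and $q=0$, then $\mathcal G_\phi$ is isomorphic to $\mathfrak D_0^n$; (c) if $2q=n$, then $\mathcal G_\phi$ is isomorphic to the direct sum of $\frac n2$ copies of $\mathfrak{aff}(\mathbb C)$; (d) if $p=0$ and $q=1$, then $\mathcal G_\phi$ is isomorphic to $\mathfrak D_{0,1}^n$.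
   Context: $\phi$ is nonderogatory if its characteristic polynomial $\chi_\phi$ and minimal polynomial coincide (up to sign). $\mathbb R[\phi]$ is the (commutative) algebra of real polynomials in $\phi$. For an Abelian subalgebra $\mathfrak B\subset\mathfrak{gl}(V)$, $\mathfrak B\ltimes V$ is $\mathfrak B\oplus V$ with bracket $[a,b]=0$, $[x,y]=0$, $[a,x]=a(x)$ for $a,b\in\mathfrak B$, $x,y\in V$. The multiplicity of a real eigenvalue is its multiplicity as a root of $\chi_\phi$; the multiplicity of a pair of complex conjugate eigenvalues $z,\bar z$ is the largest integer $m$ such that $\big((X-\mathrm{Re}(z))^2+\mathrm{Im}(z)^2\big)^m$ divides $\chi_\phi(X)$. $E_{i,j}$ is the $k\times k$ matrix with $1$ in entry $(i,j)$ and $0$ elsewhere. For $k\ge1$, $\mathfrak D_0^k:=\mathbb R[M_0]\ltimes\mathbb R^k$ with $M_0=\sum_{i=1}^{k-1}E_{i,i+1}\in\mathfrak{gl}(k,\mathbb R)$; for $k=1$, $\mathfrak D_0^1=\mathfrak{aff}(\mathbb R)$, the 2-dimensional Lie algebra with $[e_1,e_2]=e_2$. For even $k\ge2$, $\mathfrak D_{0,1}^k:=\mathbb R[M_{0,1}]\ltimes\mathbb R^k$ with $M_{0,1}=M_s+M_n$, $M_s=-\sum_{j=0}^{k/2-1}(E_{2j+1,2j+2}-E_{2j+2,2j+1})$, $M_n=\sum_{j=1}^{k-2}E_{j,j+2}$ (with $M_n=0$ for $k=2$). For $k=2$, $\mathfrak D_{0,1}^2=\mathfrak{aff}(\mathbb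 C)$, the 4-dimensional real Lie algebra with nonzero brackets $[e_1,e_3]=e_3$, $[e_1,e_4]=e_4$, $[e_2,e_3]=e_4$, $[e_2,e_4]=-e_3$. *)

(* Defs.v *)
From HB Require Import structures.
From mathcomp Require Import all_boot all_order all_algebra.
From mathcomp Require Import ring.
From mathcomp Require Import reals.
From mathcomp Require Export complex.

Set Implicit Arguments.
Unset Strict Implicit.
Unset Printing Implicit Defensive.

Import GRing.Theory.
Local Open Scope ring_scope.

HB.mixin Record Lmodule_isLieAlgebra (K : fieldType) L of GRing.Lmodule K L := {
  lie_bracket : L -> L -> L;
  lie_bracketPl : forall y, linear (lie_bracket ^~ y);
  lie_bracketPr : forall x, linear (lie_bracket x);
  lie_bracketxx : forall x, lie_bracket x x = 0;
  lie_jacobi : forall x y z,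
    lie_bracket x (lie_bracket y z) + lie_bracket y (lie_bracket z x)
      + lie_bracket z (lie_bracket x y) = 0
}.

#[short(type="lieAlgType")]
HB.structure Definition LieAlgebra (K : fieldType) :=
  { L of Lmodule_isLieAlgebra K L & GRing.Lmodule K L }.

Definition lie_isomorphic (K : fieldType) (L1 L2 : lieAlgType K) : Prop :=
  exists f : {linear L1 -> L2},
    bijective f /\ {morph f : x y / lie_bracket x y}.

Section DirectSums.
Variable K : fieldType.

(* The direct sum of a finite family, with componentwise bracket; it is the
   zero algebra when I is empty. *)
Section Family.
Variables (I : finType) (L : I -> lieAlgType K).

Definition lie_dsum : Type := {dffun forall i, L i}.
HB.instance Definition _ := Choice.copy lie_dsum {dffun forall i, L i}.
Implicit Types x y z : lie_dsum.

Definition mk_lie_dsum (f : forall i, L i) : lie_dsum :=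
  [ffun i => f i] : {dffun forall i, L i}.

Lemma lie_dsumE f i : mk_lie_dsum f i = f i.
Proof. exact: ffunE. Qed.

Lemma lie_dsumP x y : (forall i, x i = y i) <-> x = y.
Proof. by split=> [xy|-> //]; apply/ffunP. Qed.

Fact lie_dsum_addA :
  associative (fun x y => mk_lie_dsum (fun i => x i + y i)).
Proof. by move=> x y z; apply/lie_dsumP=> i; rewrite !lie_dsumE addrA. Qed.
Fact lie_dsum_addC :
  commutative (fun x y => mk_lie_dsum (fun i => x i + y i)).
Proof. by move=> x y; apply/lie_dsumP=> i; rewrite !lie_dsumE addrC. Qed.
Fact lie_dsum_add0 :
  left_id (mk_lie_dsum (fun=> 0)) (fun x y => mk_lie_dsum (fun i => x i + y i)).
Proof. by move=> x; apply/lie_dsumP=> i; rewrite !lie_dsumE add0r. Qed.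
Fact lie_dsum_addN :
  left_inverse (mk_lie_dsum (fun=> 0)) (fun x => mk_lie_dsum (fun i => - x i))
    (fun x y => mk_lie_dsum (fun i => x i + y i)).
Proof. by move=> x; apply/lie_dsumP=> i; rewrite !lie_dsumE addNr. Qed.
HB.instance Definition _ := Algebra.isZmodule.Build lie_dsum
  lie_dsum_addA lie_dsum_addC lie_dsum_add0 lie_dsum_addN.

Lemma lie_dsum_addE x y i : (x + y) i = x i + y i.
Proof. exact: lie_dsumE. Qed.
Lemma lie_dsum_0E i : (0 : lie_dsum) i = 0.
Proof. exact: lie_dsumE. Qed.

Definition lie_dsum_scale (a : K) x : lie_dsum :=
  mk_lie_dsum (fun i => a *: x i).
Fact lie_dsum_scaleA a b x :
  lie_dsum_scale a (lie_dsum_scale b x) = lie_dsum_scale (a * b) x.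
Proof. by apply/lie_dsumP=> i; rewrite !lie_dsumE scalerA. Qed.
Fact lie_dsum_scale1 : left_id 1 lie_dsum_scale.
Proof. by move=> x; apply/lie_dsumP=> i; rewrite !lie_dsumE scale1r. Qed.
Fact lie_dsum_scaleDr : right_distributive lie_dsum_scale +%R.
Proof.
move=> a x y; apply/lie_dsumP=> i.
by rewrite lie_dsum_addE !lie_dsumE scalerDr.
Qed.
Fact lie_dsum_scaleDl x : {morph lie_dsum_scale^~ x : a b / a + b}.
Proof.
by move=> a b; apply/lie_dsumP=> i; rewrite lie_dsum_addE !lie_dsumE scalerDl.
Qed.
HB.instance Definition _ := GRing.Zmodule_isLmodule.Build K lie_dsum
  lie_dsum_scaleA lie_dsum_scale1 lie_dsum_scaleDr lie_dsum_scaleDl.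

Lemma lie_dsum_scaleE a x i : (a *: x) i = a *: x i.
Proof. exact: lie_dsumE. Qed.

Definition lie_dsum_bracket x y : lie_dsum :=
  mk_lie_dsum (fun i => lie_bracket (x i) (y i)).
Fact lie_dsum_bracketPl y : linear (lie_dsum_bracket ^~ y).
Proof.
move=> a u v; apply/lie_dsumP=> i; rewrite lie_dsum_addE lie_dsum_scaleE.
by rewrite !lie_dsumE lie_bracketPl.
Qed.
Fact lie_dsum_bracketPr x : linear (lie_dsum_bracket x).
Proof.
move=> a u v; apply/lie_dsumP=> i; rewrite lie_dsum_addE lie_dsum_scaleE.
by rewrite !lie_dsumE lie_bracketPr.
Qed.
Fact lie_dsum_bracketxx x : lie_dsum_bracket x x = 0.
Proof.
by apply/lie_dsumP=> i; rewrite lie_dsum_0E lie_dsumE lie_bracketxx.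
Qed.
Fact lie_dsum_jacobi x y z :
  lie_dsum_bracket x (lie_dsum_bracket y z)
    + lie_dsum_bracket y (lie_dsum_bracket z x)
    + lie_dsum_bracket z (lie_dsum_bracket x y) = 0.
Proof.
apply/lie_dsumP=> i; rewrite lie_dsum_0E !lie_dsum_addE !lie_dsumE.
exact: lie_jacobi.
Qed.
HB.instance Definition _ := Lmodule_isLieAlgebra.Build K lie_dsum
  lie_dsum_bracketPl lie_dsum_bracketPr lie_dsum_bracketxx lie_dsum_jacobi.

End Family.

Section Pair.
Variables L1 L2 : lieAlgType K.

Definition lie_pair : Type := (L1 * L2)%type.
HB.instance Definition _ := GRing.Lmodule.copy lie_pair (L1 * L2)%type.

Definition lie_pair_bracket (x y : lie_pair) : lie_pair :=
  (lie_bracket x.1 y.1, lie_bracket x.2 y.2).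
Fact lie_pair_bracketPl y : linear (lie_pair_bracket ^~ y).
Proof. by move=> a u v; congr pair; rewrite /= lie_bracketPl. Qed.
Fact lie_pair_bracketPr x : linear (lie_pair_bracket x).
Proof. by move=> a u v; congr pair; rewrite /= lie_bracketPr. Qed.
Fact lie_pair_bracketxx x : lie_pair_bracket x x = 0.
Proof. by congr pair; rewrite lie_bracketxx. Qed.
Fact lie_pair_jacobi x y z :
  lie_pair_bracket x (lie_pair_bracket y z)
    + lie_pair_bracket y (lie_pair_bracket z x)
    + lie_pair_bracket z (lie_pair_bracket x y) = 0.
Proof. by congr pair; exact: lie_jacobi. Qed.
HB.instance Definition _ := Lmodule_isLieAlgebra.Build K lie_pair
  lie_pair_bracketPl lie_pair_bracketPr lie_pair_bracketxx lie_pair_jacobi.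

End Pair.

End DirectSums.

Definition abelian_subspace (K : fieldType) (V : vectType K)
    (B : {vspace 'End(V)}) : Prop :=
  forall f g, f \in B -> g \in B -> (f \o g = g \o f)%VF.

Section Semidirect.
Variables (K : fieldType) (V : vectType K) (B : {vspace 'End(V)}).
Hypothesis abB : abelian_subspace B.

Definition semidirect of abelian_subspace B : Type := (subvs_of B * V)%type.
Local Notation S := (semidirect abB).
HB.instance Definition _ := GRing.Lmodule.copy S (subvs_of B * V)%type.
Implicit Types x y z : S.

(* For x = (a, u) and y = (b, v), this is (0, a(v) - b(u)). *)
Definition semidirect_bracket x y : S :=
  (0, vsval x.1 y.2 - vsval y.1 x.2).

Fact semidirect_bracketPl y : linear (semidirect_bracket ^~ y).
Proof.
move=> a u v; congr pair; rewrite /= ?scaler0 ?addr0 //.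
by rewrite linearP /= add_lfunE scale_lfunE linearP /= scalerBr addrACA scalerN.
Qed.
Fact semidirect_bracketPr x : linear (semidirect_bracket x).
Proof.
move=> a u v; congr pair; rewrite /= ?scaler0 ?addr0 //.
by rewrite linearP /= add_lfunE scale_lfunE scalerBr opprD addrACA.
Qed.
Fact semidirect_bracketxx x : semidirect_bracket x x = 0.
Proof. by congr pair; rewrite subrr. Qed.
Fact semidirect_jacobi x y z :
  semidirect_bracket x (semidirect_bracket y z)
    + semidirect_bracket y (semidirect_bracket z x)
    + semidirect_bracket z (semidirect_bracket x y) = 0.
Proof.
have cB (a b : subvs_of B) v : vsval a (vsval b v) = vsval b (vsval a v).
  by rewrite -!comp_lfunE abB ?subvsP.
congr pair; rewrite /= ?addr0 // !lfunE /= !subr0 !linearB /=.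
rewrite (cB y.1 x.1) (cB z.1 x.1) (cB z.1 y.1).
by rewrite [X in X + _]addrC [X in X + _]addrA subrK addrA subrK subrr.
Qed.
HB.instance Definition _ := Lmodule_isLieAlgebra.Build K S
  semidirect_bracketPl semidirect_bracketPr
  semidirect_bracketxx semidirect_jacobi.

End Semidirect.

Section PolynomialAlgebra.
Import VectorInternalTheory.
Variables (K : fieldType) (V : vectType K).
Implicit Types (phi : 'End(V)) (p q : {poly K}).

Definition lfun_exp phi (i : nat) : 'End(V) := iter i (comp_lfun phi) \1%VF.

Definition horner_lfun phi p : 'End(V) :=
  \sum_(i < size p) p`_i *: lfun_exp phi i.

(* The subspace {p(phi) | p polynomial} of gl(V); the bound on the exponents
   is only there to have a finite sum, see memv_poly_alg. *)
Definition poly_alg phi : {vspace 'End(V)} :=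
  (\sum_(i < (\dim {:'End(V)}).+1) <[lfun_exp phi i]>)%VS.

Lemma horner_lfun_wide n phi p : (size p <= n)%N ->
  horner_lfun phi p = \sum_(i < n) p`_i *: lfun_exp phi i.
Proof.
move=> le_p_n; rewrite /horner_lfun.
rewrite (big_ord_widen n (fun i => p`_i *: lfun_exp phi i)) // big_mkcond /=.
apply: eq_bigr => i _; case: ltnP => // le_p_i.
by rewrite nth_default ?scale0r.
Qed.

Lemma horner_lfunP phi : linear (horner_lfun phi).
Proof.
move=> a p q; pose n := maxn (size p) (size q).
have lepq : (size (a *: p + q)%R <= n)%N.
  apply: leq_trans (size_polyD _ _) _; rewrite geq_max !leq_max.
  by rewrite (leq_trans (size_scale_leq _ _)) ?leqnn ?orbT.
rewrite !(@horner_lfun_wide n) ?leq_maxl ?leq_maxr // scaler_sumr -big_split /=.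
by apply: eq_bigr => i _; rewrite coefD coefZ scalerDl scalerA.
Qed.
HB.instance Definition _ phi := GRing.isLinear.Build K {poly K} 'End(V) _
  (horner_lfun phi) (horner_lfunP phi).

Lemma horner_lfunMX phi p :
  horner_lfun phi (p * 'X) = (phi \o horner_lfun phi p)%VF.
Proof.
rewrite (@horner_lfun_wide (size p).+1); last first.
  by apply: leq_trans (size_polyMleq _ _) _; rewrite size_polyX addn2.
rewrite big_ord_recl coefMX /= scale0r add0r /horner_lfun.
apply/lfunP=> v; rewrite comp_lfunE !sum_lfunE linear_sum /=.
apply: eq_bigr => i _; rewrite !scale_lfunE linearZ /= coefMX /=.
by rewrite comp_lfunE.
Qed.

Lemma horner_lfunC phi a : horner_lfun phi a%:P = a *: \1%VF.
Proof.
by rewrite (@horner_lfun_wide 1) ?size_polyC_leq1 // big_ord1 coefC.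
Qed.

Lemma horner_lfunM phi p q :
  horner_lfun phi (p * q) = (horner_lfun phi p \o horner_lfun phi q)%VF.
Proof.
elim/poly_ind: p => [|p a IHp]; first by rewrite mul0r linear0 comp_lfun0l.
rewrite mulrDl -mulrA ['X * q]mulrC mulrA !linearD /= comp_lfunDl.
rewrite !horner_lfunMX IHp comp_lfunA horner_lfunC -comp_lfunZl comp_lfun1l.
by rewrite mul_polyC linearZ.
Qed.

Lemma horner_lfunXn phi i : horner_lfun phi 'X^i = lfun_exp phi i.
Proof.
elim: i => [|i IHi]; first by rewrite expr0 horner_lfunC scale1r.
by rewrite exprSr horner_lfunMX IHi.
Qed.

Lemma memv_poly_alg phi f :
  f \in poly_alg phi <-> exists p, f = horner_lfun phi p.
Proof.
set N := \dim {:'End(V)}; split=> [|[q ->]].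
  case/memv_sumP=> g gP ->.
  have ex i : exists c, g i = c *: lfun_exp phi i.
    by have /vlineP[c ->] := gP i isT; exists c.
  have [c cP] := fin_all_exists ex.
  exists (\sum_(i < N.+1) c i *: 'X^i); rewrite linear_sum /=.
  by apply: eq_bigr => i _; rewrite linearZ /= horner_lfunXn cP.
have [c c0 cX] : exists2 c : 'I_N.+1 -> K,
    exists i, c i != 0 & \sum_(i < N.+1) c i *: lfun_exp phi i = 0.
  pose M : 'M_(N.+1, dim 'End(V)) := \matrix_(i < N.+1) v2r (lfun_exp phi i).
  have /rowV0Pn[u /sub_kermxP uM u0] : kermx M != 0.
    rewrite kermx_eq0 /row_free neq_ltn ltnS.
    by rewrite (leq_trans (rank_leq_col M)) // /N dimvf.
  exists (u 0); first by apply/rV0Pn.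
  apply: v2r_inj; rewrite linear0 -uM linear_sum /= mulmx_sum_row.
  by apply: eq_bigr => i _; rewrite linearZ /= rowK.
pose p := \poly_(i < N.+1) c (inord i).
have p0 : p != 0.
  have [i ci] := c0; apply: contraNneq ci => /polyP/(_ i).
  by rewrite coef_poly ltn_ord inord_val coef0 => ->.
have pphi : horner_lfun phi p = 0.
  rewrite (@horner_lfun_wide N.+1) ?size_poly // -[RHS]cX.
  by apply: eq_bigr => i _; rewrite coef_poly ltn_ord inord_val.
rewrite (divp_eq q p) linearD /= horner_lfunM pphi comp_lfun0r add0r.
rewrite (@horner_lfun_wide N.+1); last first.
  by apply: ltnW; apply: leq_trans (ltn_modpN0 _ p0) (size_poly _ _).
apply: rpred_sum => i _; apply: memvZ.
by rewrite memvE /poly_alg (sumv_sup i).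
Qed.

Lemma poly_alg_abelian phi : abelian_subspace (poly_alg phi).
Proof.
move=> _ _ /memv_poly_alg[p ->] /memv_poly_alg[q ->].
by rewrite -!horner_lfunM mulrC.
Qed.

Definition G_alg phi : lieAlgType K := semidirect (@poly_alg_abelian phi).

Definition matrix_of phi : 'M[K]_(\dim {:V}) :=
  passmx.mxof (vbasis {:V}) (vbasis {:V}) phi.

(* det(X - phi); it does not depend on the basis. *)
Definition lfun_char_poly phi : {poly K} := char_poly (matrix_of phi).

Definition is_min_poly phi p : Prop :=
  [/\ p \is monic, horner_lfun phi p = 0
    & forall q, q != 0 -> horner_lfun phi q = 0 -> (size p <= size q)%N].

(* lfun_char_poly is monic, so that it is equal to the minimal polynomial, and
   not only up to sign. *)
Definition nonderogatory phi : Prop := is_min_poly phi (lfun_char_poly phi).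

End PolynomialAlgebra.

Section RealEndomorphism.
Variables (R : realType) (V : vectType R).
Implicit Type phi : 'End(V).

(* Eigenvalues of phi as an endomorphism of the complexification of V. *)
Definition complex_eigenvalue phi (z : R[i]) : bool :=
  eigenvalue (map_mx (real_complex R) (matrix_of phi)) z.

Definition eigen_mult phi (x : R) : nat := mup x (lfun_char_poly phi).

Definition pair_poly (z : R[i]) : {poly R} :=
  ('X - (complex.Re z)%:P) ^+ 2 + ((complex.Im z) ^+ 2)%:P.

Definition is_pair_mult phi (z : R[i]) (m : nat) : Prop :=
  pair_poly z ^+ m %| lfun_char_poly phi /\
  forall m', pair_poly z ^+ m' %| lfun_char_poly phi -> (m' <= m)%N.

End RealEndomorphism.

Section Models.
Variable K : fieldType.

(* Matrix units, with 1-based indices; Emx k i j = 0 if i or j is out of range. *)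
Definition Emx k i j : 'M[K]_k :=
  \matrix_(a < k, b < k) ((a.+1 == i) && (b.+1 == j))%:R.

Definition M0 k : 'M[K]_k := \sum_(1 <= i < k) Emx k i i.+1.

Definition M01s k : 'M[K]_k :=
  - \sum_(0 <= j < k./2) (
    Emx k (2 * j + 1)%N (2 * j + 2)%N - Emx k (2 * j + 2)%N (2 * j + 1)%N).
Definition M01n k : 'M[K]_k := \sum_(1 <= j < k.-1) Emx k j (j + 2)%N.
Definition M01 k : 'M[K]_k := M01s k + M01n k.

Definition mx_end k (A : 'M[K]_k) : 'End('cV[K]_k) := linfun (mulmx A).

Definition D0 k : lieAlgType K := G_alg (mx_end (M0 k)).

(* Only meaningful for even k. *)
Definition D01 k : lieAlgType K := G_alg (mx_end (M01 k)).

Section StructureConstants.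
Variable n : nat.
Implicit Types x y z : 'rV[K]_n.
(* The coordinate of x /\ y on e_i /\ e_j. *)
Definition wedge i j x y : K := x 0 i * y 0 j - x 0 j * y 0 i.
End StructureConstants.

Definition affR : Type := 'rV[K]_2.
HB.instance Definition _ := GRing.Lmodule.copy affR 'rV[K]_2.
(* e_1, e_2 are affR_basis 0, affR_basis 1; likewise for affC_basis. *)
Definition affR_basis (i : 'I_2) : affR := delta_mx 0 i.

Definition affR_bracket (x y : affR) : affR :=
  wedge 0 1 x y *: affR_basis 1.

Definition affC : Type := 'rV[K]_4.
HB.instance Definition _ := GRing.Lmodule.copy affC 'rV[K]_4.
Definition affC_basis (i : 'I_4) : affC := delta_mx 0 i.

Definition affC_bracket (x y : affC) : affC :=
  wedge 0 2 x y *: affC_basis 2 + wedge 0 3 x y *: affC_basis 3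
    + wedge 1 2 x y *: affC_basis 3 - wedge 1 3 x y *: affC_basis 2.

Fact affR_bracketPl y : linear (affR_bracket ^~ y).
Proof. by move=> a u v; apply/rowP=> i; rewrite !mxE /wedge !mxE; ring. Qed.
Fact affR_bracketPr x : linear (affR_bracket x).
Proof. by move=> a u v; apply/rowP=> i; rewrite !mxE /wedge !mxE; ring. Qed.
Fact affR_bracketxx x : affR_bracket x x = 0.
Proof. by apply/rowP=> i; rewrite !mxE /wedge; ring. Qed.
Fact affR_jacobi x y z :
  affR_bracket x (affR_bracket y z) + affR_bracket y (affR_bracket z x)
    + affR_bracket z (affR_bracket x y) = 0.
Proof. by apply/rowP=> i; rewrite !mxE /wedge !mxE /= /wedge; ring. Qed.
HB.instance Definition _ := Lmodule_isLieAlgebra.Build K affR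
  affR_bracketPl affR_bracketPr affR_bracketxx affR_jacobi.

Fact affC_bracketPl y : linear (affC_bracket ^~ y).
Proof. by move=> a u v; apply/rowP=> i; rewrite !mxE /wedge !mxE; ring. Qed.
Fact affC_bracketPr x : linear (affC_bracket x).
Proof. by move=> a u v; apply/rowP=> i; rewrite !mxE /wedge !mxE; ring. Qed.
Fact affC_bracketxx x : affC_bracket x x = 0.
Proof. by apply/rowP=> i; rewrite !mxE /wedge; ring. Qed.
Fact affC_jacobi x y z :
  affC_bracket x (affC_bracket y z) + affC_bracket y (affC_bracket z x)
    + affC_bracket z (affC_bracket x y) = 0.
Proof. by apply/rowP=> i; rewrite !mxE /wedge !mxE /= /wedge; ring. Qed.
HB.instance Definition _ := Lmodule_isLieAlgebra.Build K affC
  affC_bracketPl affC_bracketPr affC_bracketxx affC_jacobi.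

Lemma affR_bracketE :
  lie_bracket (affR_basis 0) (affR_basis 1) = affR_basis 1.
Proof. by apply/rowP=> i; rewrite !mxE /wedge !mxE /= /wedge; ring. Qed.

Lemma affC_bracketE :
  [/\ lie_bracket (affC_basis 0) (affC_basis 1) = 0,
      lie_bracket (affC_basis 2) (affC_basis 3) = 0
    & [/\ lie_bracket (affC_basis 0) (affC_basis 2) = affC_basis 2,
          lie_bracket (affC_basis 0) (affC_basis 3) = affC_basis 3,
          lie_bracket (affC_basis 1) (affC_basis 2) = affC_basis 3
        & lie_bracket (affC_basis 1) (affC_basis 3) = - affC_basis 2]].
Proof. by do ![split]; apply/rowP=> i; rewrite !mxE /wedge !mxE /= /wedge; ring. Qed.

End Models.

(* Main.v *)
Require Import Defs.
From mathcomp Require Import all_boot all_order all_algebra.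
From mathcomp Require Import reals complex.
From HB Require Import structures.
From mathcomp Require Import ring zify.
Local Open Scope ring_scope.

(** A nonderogatory phi has a cyclic vector, so that V is R[X]/(chi) as a module
    over R[X] and G_phi is R[X]/(chi) acting on itself by multiplication.  By the
    Chinese remainder theorem this Lie algebra is the direct sum of its analogues
    for the prime powers (X - lambda)^k and ((X - Re z)^2 + (Im z)^2)^m, and the
    affine substitutions X -> X + lambda and X -> (Im z) X + Re z turn these into
    the ones for X^k and (X^2 + 1)^m, the minimal polynomials of M_0 and
    M_{0,1}. *)

Set Implicit Arguments.
Unset Strict Implicit.
Unset Printing Implicit Defensive.
Import Order.TTheory GRing.Theory Num.Theory.

(** * Lie algebras presented by a polynomial *)

Section Presentation.
Variable K : fieldType.
Implicit Types (L : lieAlgType K) (mu nu : {poly K}).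

(* L is the semidirect product of the algebra K[X]/(mu) and of its regular
   module; F is the quotient map. *)
Definition poly_presented L mu : Prop :=
  exists F : {linear ({poly K} * {poly K})%type -> L},
  [/\ forall x, exists pu, F pu == x,
      forall pu, (F pu == 0) = (mu %| pu.1) && (mu %| pu.2)
    & forall pu qw,
        lie_bracket (F pu) (F qw) = F (0, pu.1 * qw.2 - qw.1 * pu.2)].

(** The two quotient maps have the same kernel, so [F2] after a set-theoretic section of [F1] does
    not depend on the section; hence it is linear, respects brackets, and is inverted by the
    symmetric construction. *)
Lemma poly_presented_iso L1 L2 mu :
  poly_presented L1 mu -> poly_presented L2 mu -> lie_isomorphic L1 L2.
Proof.
case=> F1 [surj1 ker1 br1] [F2 [surj2 ker2 br2]].
pose s1 x := xchoose (surj1 x); pose s2 x := xchoose (surj2 x).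
have s1K x : F1 (s1 x) = x by apply/eqP/(xchooseP (surj1 x)).
have s2K x : F2 (s2 x) = x by apply/eqP/(xchooseP (surj2 x)).
have eqF a b : (F1 a == F1 b) = (F2 a == F2 b).
  rewrite -(subr_eq0 (F1 a)) -(subr_eq0 (F2 a)).
  by rewrite -(linearB F1) -(linearB F2) ker1 ker2.
have fF a : F2 (s1 (F1 a)) = F2 a by apply/eqP; rewrite -eqF s1K.
have f_lin : linear (F2 \o s1).
  move=> a x y; rewrite /= -[x in LHS]s1K -[y in LHS]s1K -linearP /= fF.
  by rewrite linearP.
pose f : {linear L1 -> L2} :=
  HB.pack (F2 \o s1) (GRing.isLinear.Build K L1 L2 *:%R (F2 \o s1) f_lin).
exists f; split.
  exists (F1 \o s2) => x /=; last by rewrite fF.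
  by apply/eqP; rewrite -[X in _ == X]s1K eqF s2K.
by move=> x y /=; rewrite br2 -[x in LHS]s1K -[y in LHS]s1K br1 fF.
Qed.

Lemma poly_presented_eqp L mu nu :
  mu %= nu -> poly_presented L mu -> poly_presented L nu.
Proof.
move=> mn [F [surj ker br]]; exists F; split=> // pu.
by rewrite ker !(eqp_dvdl _ mn).
Qed.

(** An invertible affine substitution is an automorphism of K[X]. The presentation is precomposed
    with the substitution of [t], the inverse of [s], and [mu] divides [p \Po t] exactly when
    [mu \Po s] divides [p]. *)
Lemma poly_presented_comp L mu a b : a != 0 ->
  poly_presented L mu -> poly_presented L (mu \Po (a *: 'X + b%:P)).
Proof.
move=> a0 [F [surj ker br]].
pose s : {poly K} := a *: 'X + b%:P.
pose t : {poly K} := a^-1 *: ('X - b%:P).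
have ts : t \Po s = 'X.
  by rewrite comp_polyZ comp_polyB comp_polyX comp_polyC addrK scalerA mulVf
    ?scale1r.
have st : s \Po t = 'X.
  by rewrite comp_polyD comp_polyZ comp_polyX comp_polyC scalerA divff // scale1r
    subrK.
pose G0 (pu : {poly K} * {poly K}) := F (pu.1 \Po t, pu.2 \Po t).
have Glin : linear G0.
  move=> c x y; rewrite /G0 -linearP; congr (F _).
  by congr pair; rewrite /= linearP.
pose G : {linear ({poly K} * {poly K})%type -> L} :=
  HB.pack G0 (GRing.isLinear.Build K _ L *:%R G0 Glin).
exists G; split=> [x | pu | pu qw] /=.
- have [pu /eqP <-] := surj x; exists (pu.1 \Po s, pu.2 \Po s).
  by rewrite /G0 /= -!comp_polyA st !comp_polyXr -surjective_pairing.
- have dE p : (mu %| p \Po t) = (mu \Po s %| p).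
    apply/idP/idP=> [/(dvdp_comp_poly s)|/(dvdp_comp_poly t)].
      by rewrite -comp_polyA ts comp_polyXr.
    by rewrite -comp_polyA st comp_polyXr.
  by rewrite /G0 ker /= !dE.
by rewrite /G0 br /= comp_poly0 comp_polyB !comp_polyM.
Qed.

End Presentation.

(** * Chinese remainders and direct sums *)

Section DirectSum.
Variable K : fieldType.
Implicit Types (mu nu : {poly K}).

Lemma coprimep_prodr (I : Type) (r : seq I) (P : pred I)
    (mu : I -> {poly K}) nu :
  (forall i, P i -> coprimep nu (mu i)) ->
  coprimep nu (\prod_(i <- r | P i) mu i).
Proof.
move=> cop; elim/big_rec: _ => [|i p Pi cp]; first exact: coprimep1.
by rewrite coprimepMr cop.
Qed.

Lemma dvdp_prod_coprime (I : finType) (mu : I -> {poly K}) p :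
  (forall i j, i != j -> coprimep (mu i) (mu j)) ->
  (\prod_i mu i %| p) = [forall i, mu i %| p].
Proof.
move=> cop; apply/idP/forallP => [dp i | dp].
  by apply: dvdp_trans dp; rewrite (bigD1 i) //= dvdp_mulr.
have: uniq (index_enum I) := index_enum_uniq I.
elim: (index_enum I) => [|i r IHr] /=; first by rewrite big_nil dvd1p.
case/andP=> ir ur; rewrite big_cons Gauss_dvdp ?dp ?IHr //.
rewrite big_seq; apply: coprimep_prodr => j jr; apply: cop.
by apply: contraNneq ir => ->.
Qed.

Lemma chinese_poly (I : finType) (mu : I -> {poly K}) (f : I -> {poly K}) :
  (forall i j, i != j -> coprimep (mu i) (mu j)) ->
  exists p, forall i, mu i %| p - f i.
Proof.
move=> cop.
(* Idempotents modulo the product, obtained from Bezout relations. *)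
have ex i : exists e, mu i %| e - 1 /\ forall j, j != i -> mu j %| e.
  have /Bezout_eq1_coprimepP[[u v] /= uv] :
      coprimep (mu i) (\prod_(j | j != i) mu j).
    by apply: coprimep_prodr => j ji; rewrite cop // eq_sym.
  exists (v * \prod_(j | j != i) mu j); split.
    set N := \prod_(j | _) _ in uv *.
    have -> : v * N - 1 = - (u * mu i) by rewrite -uv; ring.
    by rewrite dvdpNr dvdp_mull.
  by move=> j ji; rewrite dvdp_mull // (bigD1 j) //= dvdp_mulr.
have [e eP] := fin_all_exists ex.
exists (\sum_i e i * f i) => i; rewrite (bigD1 i) //= addrAC.
have -> : e i * f i - f i = (e i - 1) * f i by rewrite mulrBl mul1r.
rewrite dvdp_add ?dvdp_mulr //; first by case: (eP i).
apply: (big_ind (fun p => mu i %| p)) => [||j ji].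
- exact: dvdp0.
- exact: dvdp_add.
by rewrite dvdp_mulr //; apply: (eP j).2; rewrite eq_sym.
Qed.

(** All quotient maps are applied to the same pair of polynomials: coprimality gives the kernel, and
    Chinese remainders for each of the two entries give surjectivity. *)
Lemma poly_presented_dsum (I : finType) (L : I -> lieAlgType K)
    (mu : I -> {poly K}) :
  (forall i j, i != j -> coprimep (mu i) (mu j)) ->
  (forall i, poly_presented (L i) (mu i)) ->
  poly_presented (lie_dsum L) (\prod_i mu i).
Proof.
move=> cop /fin_all_exists[F FP].
pose G0 pu : lie_dsum L := mk_lie_dsum (fun i => F i pu).
have Glin : linear G0.
  move=> c x y; apply/lie_dsumP=> i.
  by rewrite lie_dsum_addE lie_dsum_scaleE !lie_dsumE linearP.
pose G : {linear ({poly K} * {poly K})%type -> lie_dsum L} :=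
  HB.pack G0 (GRing.isLinear.Build K _ (lie_dsum L) *:%R G0 Glin).
exists G; split=> [x | pu | pu qw] /=.
- have ex i : exists pu, F i pu == x i by case: (FP i) => surj _ _; apply: surj.
  have [f fx] := fin_all_exists ex.
  have [p pP] := chinese_poly (fun i => (f i).1) cop.
  have [u uP] := chinese_poly (fun i => (f i).2) cop.
  exists (p, u); apply/eqP/lie_dsumP => i; rewrite lie_dsumE -(eqP (fx i)).
  apply/eqP; rewrite -subr_eq0 -(linearB (F i)).
  by case: (FP i) => _ -> _; rewrite /= pP uP.
- rewrite !dvdp_prod_coprime //; apply/eqP/andP => [G0pu | [dp du]].
    have d i : (mu i %| pu.1) && (mu i %| pu.2).
      case: (FP i) => _ <- _; have /lie_dsumP/(_ i) := G0pu.
      by rewrite lie_dsumE lie_dsum_0E => ->.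
    by split; apply/forallP => i; case/andP: (d i).
  apply/lie_dsumP => i; rewrite lie_dsumE lie_dsum_0E; apply/eqP.
  by case: (FP i) => _ -> _; rewrite (forallP dp) (forallP du).
apply/lie_dsumP => i; rewrite /lie_bracket /= !lie_dsumE.
by case: (FP i) => _ _ ->.
Qed.

(** Serves to join the sum over the real eigenvalues to the sum over the conjugate pairs. *)
Lemma poly_presented_pair (L1 L2 : lieAlgType K) mu nu :
  coprimep mu nu -> poly_presented L1 mu -> poly_presented L2 nu ->
  poly_presented (lie_pair L1 L2) (mu * nu).
Proof.
move=> cop [F1 [surj1 ker1 br1]] [F2 [surj2 ker2 br2]].
pose G0 pu : lie_pair L1 L2 := (F1 pu, F2 pu).
have Glin : linear G0 by move=> c x y; congr pair; rewrite linearP.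
pose G : {linear ({poly K} * {poly K})%type -> lie_pair L1 L2} :=
  HB.pack G0 (GRing.isLinear.Build K _ (lie_pair L1 L2) *:%R G0 Glin).
exists G; split=> [[x1 x2] | pu | pu qw] /=.
- have [f1 /eqP fx1] := surj1 x1; have [f2 /eqP fx2] := surj2 x2.
  have [[a b] /= ab] := Bezout_eq1_coprimepP _ _ cop.
  (* Since [a * mu + b * nu = 1], the factor [b * nu] is 1 modulo [mu], and [a * mu] is 1 modulo
     [nu]. *)
  have ch f g : mu %| (b * nu * f + a * mu * g) - f /\
                nu %| (b * nu * f + a * mu * g) - g.
    split.
      have -> : b * nu * f + a * mu * g - f = mu * (a * (g - f)).
        by rewrite -[f in X in _ - X]mul1r -ab; ring.
      exact: dvdp_mulr.
    have -> : b * nu * f + a * mu * g - g = nu * (b * (f - g)).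
      by rewrite -[g in X in _ - X]mul1r -ab; ring.
    exact: dvdp_mulr.
  have [p1 p2] := ch f1.1 f2.1; have [u1 u2] := ch f1.2 f2.2.
  eexists (_, _); apply/eqP; congr pair.
    rewrite -fx1; apply/eqP; rewrite -subr_eq0 -(linearB F1) ker1.
    by apply/andP; split; [apply: p1 | apply: u1].
  rewrite -fx2; apply/eqP; rewrite -subr_eq0 -(linearB F2) ker2.
  by apply/andP; split; [apply: p2 | apply: u2].
- rewrite !Gauss_dvdp // andbACA -ker1 -ker2.
  by apply/eqP/andP => [[-> ->] | [/eqP e1 /eqP e2]]; rewrite /G0 ?e1 ?e2 ?eqxx.
by congr pair; [apply: br1 | apply: br2].
Qed.

End DirectSum.

(** * Orders of vectors and cyclic vectors *)

Section Order.
Variables (K : fieldType) (V : vectType K).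
Implicit Types (phi : 'End(V)) (v : V) (mu p : {poly K}).

(** The annihilator of [v] in K[X] is the ideal generated by [mu], which fixes [mu] only up to a
    nonzero scalar. *)
Definition is_order phi v mu : Prop :=
  forall p, (horner_lfun phi p v == 0) = (mu %| p).

Lemma is_order_eqp phi v mu nu :
  mu %= nu -> is_order phi v mu -> is_order phi v nu.
Proof. by move=> mn ord p; rewrite ord (eqp_dvdl _ mn). Qed.

Lemma horner_lfunMv phi p q v :
  horner_lfun phi (p * q) v = horner_lfun phi p (horner_lfun phi q v).
Proof. by rewrite horner_lfunM comp_lfunE. Qed.

Lemma horner_lfun_dvd phi p q v :
  p %| q -> horner_lfun phi p v = 0 -> horner_lfun phi q v = 0.
Proof. by case/dvdpP=> r -> pv; rewrite horner_lfunMv pv linear0. Qed.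

(** By Bezout, the gcd of [p] and [mu ^+ e.+1] also kills [v]; it cannot divide [mu ^+ e], so it is
    the full power up to a scalar. *)
Lemma is_order_irreducible phi v mu e :
    irreducible_poly mu -> horner_lfun phi (mu ^+ e.+1) v = 0 ->
    horner_lfun phi (mu ^+ e) v != 0 ->
  is_order phi v (mu ^+ e.+1).
Proof.
move=> irr me0 me p; apply/eqP/idP => [p0 | /horner_lfun_dvd/(_ me0) //].
have [[u w] /= uw] := Bezoutp p (mu ^+ e.+1).
have g0 : horner_lfun phi (gcdp p (mu ^+ e.+1)) v = 0.
  apply: (@horner_lfun_dvd _ (u * p + w * mu ^+ e.+1)).
    by rewrite (eqp_dvdl _ uw).
  by rewrite linearD /= add_lfunE !horner_lfunMv p0 me0 !linear0 addr0.
have /dvdpP[r rE] := dvdp_gcdr p (mu ^+ e.+1).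
have [/dvdpP[s sE] | nd] := boolP (mu %| r).
  case/eqP: me; apply: horner_lfun_dvd g0; apply/dvdpP; exists s.
  apply: (mulfI (irredp_neq0 irr)).
  by rewrite -exprS {1}rE sE mulrA [mu * s]mulrC.
have cr : coprimep (mu ^+ e.+1) r.
  by rewrite coprimep_expl // irreducible_poly_coprime.
apply: dvdp_trans (dvdp_gcdl p (mu ^+ e.+1)).
by rewrite -(Gauss_dvdpr _ cr) -rE.
Qed.

Lemma is_orderD phi u v mu nu : coprimep mu nu ->
  is_order phi u mu -> is_order phi v nu -> is_order phi (u + v) (mu * nu).
Proof.
(* If [p] kills [x + y], then [g * p] kills [x = (x + y) - y], because [g] kills [y]; so [f] divides
   [g * p], and coprimality removes [g]. *)
have half x y f g p : coprimep f g -> is_order phi x f -> is_order phi y g ->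
    horner_lfun phi p (x + y) = 0 -> f %| p.
  move=> fg xf yg pxy; rewrite -(Gauss_dvdpr _ fg) -xf.
  have gy : horner_lfun phi g y = 0 by apply/eqP; rewrite yg dvdpp.
  have -> : x = (x + y) - y by rewrite addrK.
  rewrite linearB /= horner_lfunMv pxy linear0 mulrC horner_lfunMv gy linear0.
  by rewrite subr0.
move=> cop ou ov p; rewrite Gauss_dvdp //; apply/eqP/andP => [puv | [mp np]].
  split; first exact: (half u v _ nu).
  by rewrite addrC in puv; apply: (half v u _ mu); rewrite // coprimep_sym.
rewrite linearD /=; move: mp np; rewrite -ou -ov => /eqP-> /eqP->.
by rewrite addr0.
Qed.

Lemma is_order_sum (I : finType) phi (v : I -> V) (mu : I -> {poly K}) :
  (forall i j, i != j -> coprimep (mu i) (mu j)) ->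
  (forall i, is_order phi (v i) (mu i)) ->
  is_order phi (\sum_i v i) (\prod_i mu i).
Proof.
move=> cop ord; have: uniq (index_enum I) := index_enum_uniq I.
elim: (index_enum I) => [|i r IHr] /=.
  by rewrite !big_nil => _ p; rewrite linear0 eqxx dvd1p.
case/andP=> ir ur; rewrite !big_cons; apply: is_orderD => //; last exact: IHr.
rewrite big_seq; apply: coprimep_prodr => j jr; apply: cop.
by apply: contraNneq ir => ->.
Qed.

(** Evaluation at [v] is injective on polynomials of degree less than dim V, encoded as row vectors,
    because [mu] has degree dim V; by equality of dimensions it is surjective. *)
Lemma order_cyclic phi v mu : is_order phi v mu -> size mu = (\dim {:V}).+1 ->
  forall x, exists p, horner_lfun phi p v = x.
Proof.
move=> ord szmu x; pose n := \dim {:V}.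
pose f0 (a : 'rV[K]_n) := horner_lfun phi (rVpoly a) v.
have flin : linear f0.
  by move=> c a b; rewrite /f0 !linearP /= add_lfunE scale_lfunE.
pose f : {linear 'rV[K]_n -> V} :=
  HB.pack f0 (GRing.isLinear.Build K _ V *:%R f0 flin).
have kerf : lker (linfun f) == 0%VS.
  rewrite -subv0; apply/subvP => a.
  rewrite memv_ker lfunE /= /f0 ord memv0 => da.
  have [/eqP|nz] := boolP (rVpoly a == 0).
    by move/(congr1 (@poly_rV _ n)); rewrite rVpolyK linear0 => ->.
  by have := dvdp_leq nz da; rewrite szmu leqNgt ltnS size_poly.
have : x \in limg (linfun f).
  suff -> : limg (linfun f) = fullv by exact: memvf.
  apply/eqP; rewrite eqEdim subvf limg_dim_eq ?(eqP kerf) ?capv0 //.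
  by rewrite (dimvf 'rV[K]_n) dim_matrix mul1r leqnn.
by case/memv_imgP => a _ ->; exists (rVpoly a); rewrite lfunE.
Qed.

(** The vector [v] is cyclic, so u -> u(phi) v identifies K[X]/(mu) with V, while p -> p(phi)
    identifies it with [poly_alg phi]. *)
Lemma poly_presented_G_alg phi v mu :
  is_order phi v mu -> size mu = (\dim {:V}).+1 ->
  poly_presented (G_alg phi) mu.
Proof.
move=> ord /(order_cyclic ord) cyc.
pose G0 (pu : {poly K} * {poly K}) : G_alg phi :=
  (vsproj (poly_alg phi) (horner_lfun phi pu.1), horner_lfun phi pu.2 v).
have Glin : linear G0.
  move=> c x y; congr pair; rewrite /= !linearP //.
  by rewrite add_lfunE scale_lfunE.
pose G : {linear ({poly K} * {poly K})%type -> G_alg phi} :=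
  HB.pack G0 (GRing.isLinear.Build K _ (G_alg phi) *:%R G0 Glin).
have valG p :
    vsval (vsproj (poly_alg phi) (horner_lfun phi p)) = horner_lfun phi p.
  by rewrite vsprojK //; apply/memv_poly_alg; exists p.
exists G; split=> [[a x] | pu | pu qw] /=.
- have [p pE] := (memv_poly_alg phi (vsval a)).1 (subvsP a).
  have [u uE] := cyc x; exists (p, u); apply/eqP; congr pair => //=.
  by apply: val_inj; rewrite /= valG.
- have p0 : (vsproj (poly_alg phi) (horner_lfun phi pu.1) == 0) = (mu %| pu.1).
    rewrite -ord; apply/eqP/eqP => [e | e].
      by rewrite -valG e lfunE.
    (* Polynomials in [phi] commute, so one that kills the cyclic vector kills all of V. *)
    suff -> : horner_lfun phi pu.1 = 0 by rewrite linear0.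
    apply/lfunP => x; have [q <-] := cyc x.
    by rewrite -horner_lfunMv mulrC horner_lfunMv e linear0 lfunE.
  rewrite -p0 -ord; apply/eqP/andP => [[-> ->] // | [/eqP e1 /eqP e2]].
  by rewrite /G0 e1 e2.
congr pair; first by rewrite /= !linear0.
by rewrite /= !valG linearB /= add_lfunE opp_lfunE !horner_lfunMv.
Qed.

(** For each prime factor, a vector not killed by [chi / mu i] yields one of order [mu i ^+ e i];
    these orders are coprime, so the sum of the vectors has their product as order. *)
Lemma min_poly_cyclic (I : finType) phi (mu : I -> {poly K}) (e : I -> nat)
    chi :
    is_min_poly phi chi ->
    (forall i, irreducible_poly (mu i)) ->
    (forall i j, i != j -> coprimep (mu i) (mu j)) ->
    chi %= \prod_i mu i ^+ e i ->
  exists v, is_order phi v chi.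
Proof.
move=> [mon chi0 minchi] irr cop chiE.
have cope i j : i != j -> coprimep (mu i ^+ e i) (mu j ^+ e j).
  by move=> ij; rewrite coprimep_expl // coprimep_expr // cop.
have ex i : exists v, is_order phi v (mu i ^+ e i).
  case eE : (e i) => [|n].
    by exists 0 => p; rewrite linear0 eqxx expr0 dvd1p.
  have /dvdpP[r rE] : mu i ^+ n.+1 %| chi.
    by rewrite (eqp_dvdr _ chiE) (bigD1 i) //= eE dvdp_mulr.
  have chin0 := monic_neq0 mon.
  (* This is [chi / mu i], of smaller degree than [chi], so by minimality it does not annihilate
     [phi]. *)
  pose s := mu i ^+ n * r.
  have sE : chi = s * mu i by rewrite rE /s exprSr mulrC -!mulrA [r * _]mulrC.
  have s0 : s != 0 by apply: contraNneq chin0 => s0; rewrite sE s0 mul0r.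
  have : horner_lfun phi s != 0.
    apply/negP => /eqP /(minchi _ s0); rewrite sE size_mul // ?irredp_neq0 //.
    have [sz _] := irr i; rewrite -ltnS.
    case: (size (mu i)) sz => [|[|k]] // _.
    by rewrite !addnS /= ltnNge ltnS leq_addr.
  case/lfunPn => x; rewrite lfunE /= /s horner_lfunMv => nz.
  exists (horner_lfun phi r x); apply: is_order_irreducible => //.
  by rewrite -horner_lfunMv mulrC -rE chi0 lfunE.
have [v ov] := fin_all_exists ex; exists (\sum_i v i).
by apply: is_order_eqp (is_order_sum cope ov); rewrite eqp_sym.
Qed.

End Order.

(** * The nilpotent block [M0], the algebra [affR], and the two parts of [M01] *)

Section Models.
Variable K : fieldType.

Lemma mx_endE k (A : 'M[K]_k) v : mx_end A v = A *m v.
Proof. by rewrite lfunE. Qed.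

Lemma dim_cV k : \dim {: 'cV[K]_k} = k.
Proof. by rewrite dimvf dim_matrix mulr1. Qed.

(* The standard basis with 1-based indices, so that e_0 = 0. *)
Definition basis_cV k i : 'cV[K]_k := \col_(a < k) (a.+1 == i)%:R.
Arguments basis_cV (k i)%_N.

Lemma basis_cV0 k : basis_cV k 0 = 0.
Proof. by apply/colP => a; rewrite !mxE. Qed.

Lemma basis_cV_neq0 k i : (i < k)%N -> basis_cV k i.+1 != 0.
Proof.
move=> ik; apply/eqP => /colP/(_ (Ordinal ik)); rewrite !mxE eqxx => /eqP.
by rewrite oner_eq0.
Qed.

Lemma Emx_basis k i j l : (0 < j <= k)%N ->
  Emx K k i j *m basis_cV k l = (j == l)%:R *: basis_cV k i.
Proof.
case: j => // j jk; apply/colP => a.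
rewrite !mxE (bigD1 (Ordinal jk)) //= !mxE eqxx andbT.
rewrite big1 ?addr0 1?mulrC // => b bj; rewrite !mxE eqSS.
by have /negPf-> : val b != j by []; rewrite andbF mul0r.
Qed.

Lemma col_basis k (A : 'M[K]_k) (a : 'I_k) : col a A = A *m basis_cV k a.+1.
Proof.
apply/colP => b.
rewrite !mxE (bigD1 a) //= mxE eqxx mulr1 big1 ?addr0 // => c ca.
by rewrite mxE eqSS (negPf (ca : val c != val a)) mulr0.
Qed.

Lemma M0_basis k i : (i < k)%N -> M0 K k *m basis_cV k i.+1 = basis_cV k i.
Proof.
move=> ik; rewrite mulmx_suml.
rewrite (eq_big_nat _ _ (F2 :=
    fun j => (j == i)%:R *: basis_cV k j)); last first.
  by move=> j /andP[j0 jk]; rewrite Emx_basis ?eqSS.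
case: i ik => [|i] ik.
  rewrite big_nat_cond big1 ?basis_cV0 // => j /andP[/andP[]].
  by case: j => // j *; rewrite scale0r.
rewrite (bigD1_seq i.+1) ?mem_index_iota ?iota_uniq //= eqxx scale1r.
by rewrite big1 ?addr0 // => j /negPf->; rewrite scale0r.
Qed.

(** The last basis vector is cyclic: [M0] lowers indices by one, so X^i sends e_k to e_{k-i}, which
    vanishes for i = k but not for i < k. *)
Lemma poly_presented_D0 k : poly_presented (D0 K k) 'X^k.
Proof.
have Xe i : (i <= k)%N ->
    horner_lfun (mx_end (M0 K k)) ('X^i) (basis_cV k k) = basis_cV k (k - i).
  elim: i => [|i IHi] ik; first by rewrite horner_lfunXn lfunE subn0.
  rewrite exprS horner_lfunMv IHi; last exact: ltnW.
  rewrite -['X]expr1 horner_lfunXn /= comp_lfun1r mx_endE -(subnSK ik).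
  by rewrite M0_basis //; lia.
apply: (@poly_presented_G_alg _ _ _ (basis_cV k k)); last first.
  by rewrite size_polyXn dim_cV.
case: k Xe => [|n] Xe.
  by move=> p; rewrite basis_cV0 linear0 eqxx expr0 dvd1p.
have -> : 'X = 'X - 0%:P :> {poly K} by rewrite subr0.
apply: is_order_irreducible; first exact: irredp_XsubC.
  by rewrite subr0 Xe // subnn basis_cV0.
by rewrite subr0 Xe // subSnn basis_cV_neq0.
Qed.

(** K[X]/(X) is K, by evaluation at 0. *)
Lemma poly_presented_affR : poly_presented (affR K) 'X.
Proof.
pose G0 (pu : {poly K} * {poly K}) : affR K :=
  \row_i (if i == 0 then pu.1.[0] else pu.2.[0]).
have Glin : linear G0.
  by move=> c x y; apply/rowP=> i; rewrite !mxE; case: ifP; rewrite !hornerE.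
pose G : {linear ({poly K} * {poly K})%type -> affR K} :=
  HB.pack G0 (GRing.isLinear.Build K _ (affR K) *:%R G0 Glin).
have dX p : ('X %| p) = (p.[0] == 0).
  by rewrite -['X]subr0 -polyC0 dvdp_XsubCl.
exists G; split=> [x | pu | pu qw] /=.
- exists ((x 0 0)%:P, (x 0 1)%:P); apply/eqP/rowP => i; rewrite mxE /= !hornerC.
  by case: i => [[|[|//]] ilt]; rewrite /=; congr (x _ _); apply: val_inj.
- rewrite !dX; apply/eqP/andP => [e | [/eqP e1 /eqP e2]].
    have h j := congr1 (fun x : 'rV_2 => x 0 j) e; move: (h 0) (h 1).
    by rewrite !mxE /= => -> ->.
  by apply/rowP => i; rewrite !mxE e1 e2; case: ifP.
apply/rowP => i; rewrite /lie_bracket /= /affR_bracket /wedge !mxE /=.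
by case: i => [[|[|//]] ilt] /=; rewrite !hornerE; ring.
Qed.

Lemma poly_presented_D0_XsubC (a : K) k :
  poly_presented (D0 K k) (('X - a%:P) ^+ k).
Proof.
have := poly_presented_comp (- a) (oner_neq0 K) (poly_presented_D0 k).
by rewrite comp_Xn_poly scale1r polyCN.
Qed.

Lemma poly_presented_affR_XsubC (a : K) : poly_presented (affR K) ('X - a%:P).
Proof.
have := poly_presented_comp (- a) (oner_neq0 K) poly_presented_affR.
by rewrite comp_polyX scale1r polyCN.
Qed.

(** The truncated predecessor covers the first two basis vectors, which both go to e_0 = 0. *)
Lemma M01n_basis k i :
  (i < k)%N -> M01n K k *m basis_cV k i.+1 = basis_cV k i.-1.
Proof.
move=> ik; rewrite mulmx_suml.
rewrite (eq_big_nat _ _ (F2 :=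
    fun j => (j == i.-1)%:R *: basis_cV k j)); last first.
  move=> j /andP[j0 jk]; rewrite Emx_basis; last by rewrite addn2 /=; lia.
  by rewrite addn2 eqSS; case: i ik => //=; case: j j0 jk.
case: i ik => [|[|i]] ik /=.
- rewrite big_nat_cond big1 ?basis_cV0 // => j /andP[/andP[]].
  by case: j => // j *; rewrite scale0r.
- rewrite big_nat_cond big1 ?basis_cV0 // => j /andP[/andP[]].
  by case: j => // j *; rewrite scale0r.
rewrite (bigD1_seq i.+1) ?mem_index_iota ?iota_uniq //=; last by lia.
rewrite eqxx scale1r.
by rewrite big1 ?addr0 // => j /negPf->; rewrite scale0r.
Qed.

(** [M01s] is the complex structure of each coordinate plane, whose two basis vectors play the roles
    of 1 and of the imaginary unit. *)
Lemma M01s_basis_odd m i : (i < m)%N ->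
  M01s K (2 * m)%N *m basis_cV (2 * m) (2 * i).+1 =
    basis_cV (2 * m) (2 * i).+2.
Proof.
move=> im; rewrite mulNmx mulmx_suml mul2n doubleK -!mul2n.
rewrite (eq_big_nat _ _ (F2 :=
    fun j => (- (j == i)%:R) *: basis_cV (2 * m) (2 * j).+2)); last first.
  move=> j /andP[_ jm]; rewrite mulmxBl !Emx_basis ?addn1 ?addn2; try by lia.
  rewrite !eqSS eqn_mul2l /=.
  have /negPf-> : ((2 * j).+1 != 2 * i)%N by lia.
  by rewrite scale0r sub0r scaleNr.
rewrite (bigD1_seq i) ?mem_index_iota ?iota_uniq //= eqxx scaleN1r.
by rewrite big1 ?addr0 ?opprK // => j /negPf->; rewrite oppr0 scale0r.
Qed.

Lemma M01s_basis_even m i : (i < m)%N ->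
  M01s K (2 * m)%N *m basis_cV (2 * m) (2 * i).+2 =
    - basis_cV (2 * m) (2 * i).+1.
Proof.
move=> im; rewrite mulNmx mulmx_suml mul2n doubleK -!mul2n.
rewrite (eq_big_nat _ _ (F2 :=
    fun j => (j == i)%:R *: basis_cV (2 * m) (2 * j).+1)); last first.
  move=> j /andP[_ jm]; rewrite mulmxBl !Emx_basis ?addn1 ?addn2; try by lia.
  rewrite !eqSS eqn_mul2l /=.
  have /negPf-> : ((2 * j) != (2 * i).+1)%N by lia.
  by rewrite scale0r subr0.
rewrite (bigD1_seq i) ?mem_index_iota ?iota_uniq //= eqxx scale1r.
by rewrite big1 ?addr0 // => j /negPf->; rewrite scale0r.
Qed.

Lemma eq_mx_basis m (A B : 'M[K]_(2 * m)%N) :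
    (forall i, (i < m)%N ->
      A *m basis_cV (2 * m) (2 * i).+1 = B *m basis_cV (2 * m) (2 * i).+1) ->
    (forall i, (i < m)%N ->
      A *m basis_cV (2 * m) (2 * i).+2 = B *m basis_cV (2 * m) (2 * i).+2) ->
  A = B.
Proof.
move=> eo ee; apply/matrixP => b a.
suff /colP/(_ b) : col a A = col a B by rewrite !mxE.
rewrite !col_basis; have am := ltn_ord a.
(* Columns are numbered from 0 and basis vectors from 1, so even columns fall under [eo]. *)
have [o|o] : (a = 2 * (a./2) :> nat)%N \/ (a = (2 * (a./2))%N.+1 :> nat) by lia.
  by rewrite o eo //; lia.
by rewrite o ee //; lia.
Qed.

Lemma M01s_sqr m : M01s K (2 * m)%N *m M01s K (2 * m)%N = - 1%:M.
Proof.
apply: eq_mx_basis => i im; rewrite -mulmxA (mulNmx 1%:M) mul1mx.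
  by rewrite M01s_basis_odd // M01s_basis_even.
by rewrite M01s_basis_even // mulmxN M01s_basis_odd.
Qed.

(** [M01n] moves each plane onto the preceding one, the first to 0, and [M01s] acts in the same way
    on all planes. *)
Lemma M01s_nC m :
  M01s K (2 * m)%N *m M01n K (2 * m)%N = M01n K (2 * m)%N *m M01s K (2 * m)%N.
Proof.
apply: eq_mx_basis => i im; rewrite -!mulmxA.
  rewrite M01s_basis_odd // !M01n_basis ?/=; try by lia.
  case: i im => [|i] im; first by rewrite muln0 /= basis_cV0 mulmx0.
  by rewrite mulnS /= M01s_basis_odd //; lia.
rewrite M01s_basis_even // mulmxN !M01n_basis ?/=; try by lia.
case: i im => [|i] im; first by rewrite muln0 /= basis_cV0 mulmx0 oppr0.
by rewrite mulnS /= M01s_basis_even //; lia.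
Qed.

End Models.

(** * Real quadratic factors, [affC] and [M01] *)

Section PairPoly.
Variable R : realType.
Implicit Types (z : R[i]) (p : {poly R}).

Lemma size_pair_poly z : size (pair_poly z) = 3.
Proof.
rewrite size_polyDl size_exp_XsubC // size_polyC.
by case: eqP.
Qed.

Lemma size_pair_poly_exp z k : size (pair_poly z ^+ k) = (2 * k).+1.
Proof.
have p0 : pair_poly z != 0 by rewrite -size_poly_gt0 size_pair_poly.
by rewrite -[LHS]prednK ?size_poly_gt0 ?expf_neq0 // size_exp size_pair_poly.
Qed.

Lemma pair_poly_map z :
  map_poly (real_complex R) (pair_poly z) = ('X - z%:P) * ('X - (conjc z)%:P).
Proof.
case: z => a b.
rewrite /pair_poly /= rmorphD rmorphXn rmorphB /= map_polyX !map_polyC /=.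
have -> : (Complex a b) = a%:C%C + 'i%C * b%:C%C by simpc.
have -> : (Complex a (- b)) = a%:C%C - 'i%C * b%:C%C by simpc.
rewrite !rmorphD !rmorphN !rmorphM /=.
have i2 : ('i%C%:P : {poly R[i]}) * 'i%C%:P = - 1.
  by rewrite -rmorphM /= -[X in X%:P]expr2 sqr_i rmorphN1.
set A := (a%:C%C)%:P; set B := (b%:C%C)%:P; set I := ('i%C)%:P in i2 *.
have -> : ('X - (A + I * B)) * ('X - (A - I * B)) =
    ('X - A) ^+ 2 - (I * I) * B ^+ 2.
  by ring.
by rewrite i2 mulN1r opprK.
Qed.

(** In degree two it suffices to have no root, and this polynomial is positive on the reals. *)
Lemma pair_poly_irreducible z :
  complex.Im z != 0 -> irreducible_poly (pair_poly z).
Proof.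
move=> im; apply: cubic_irreducible; first by rewrite size_pair_poly.
move=> x; rewrite /root /pair_poly !hornerE gt_eqF //.
by rewrite ltr_wpDl ?sqr_ge0 // exprn_even_gt0.
Qed.

(** [pair_poly z] is the minimal polynomial of [z] over the reals: were it coprime to a [p]
    vanishing at [z], a Bezout relation evaluated at [z] would read 0 = 1. *)
Lemma pair_poly_dvd z p : complex.Im z != 0 ->
  (pair_poly z %| p) = root (map_poly (real_complex R) p) z.
Proof.
move=> im; apply/idP/idP => [/dvdpP[q ->] | rt].
  by rewrite rmorphM /= pair_poly_map rootM rootM root_XsubC eqxx orbT.
apply: contraT; rewrite -irreducible_poly_coprime; last first.
  exact: pair_poly_irreducible.
case/Bezout_eq1_coprimepP => -[u v] /= /(congr1 (map_poly (real_complex R))).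
rewrite rmorphD !rmorphM rmorph1 /= pair_poly_map => /(congr1 (horner^~ z)).
rewrite hornerD !hornerM hornerXsubC subrr mul0r (rootP rt) !mulr0 addr0.
rewrite hornerC => /eqP.
by rewrite eq_sym oner_eq0.
Qed.

Lemma pair_poly_coprime z w : complex.Im z != 0 -> complex.Im w != 0 ->
  z != w -> z != conjc w -> coprimep (pair_poly z) (pair_poly w).
Proof.
move=> imz imw zw zcw; rewrite irreducible_poly_coprime; last first.
  exact: pair_poly_irreducible.
by rewrite pair_poly_dvd // pair_poly_map rootM !root_XsubC negb_or zw.
Qed.

Lemma pair_poly_XsubC_coprime z (x : R) : complex.Im z != 0 ->
  coprimep (pair_poly z) ('X - x%:P).
Proof.
move=> im; rewrite irreducible_poly_coprime; last exact: pair_poly_irreducible.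
apply/negP => /dvdp_leq.
by rewrite polyXsubC_eq0 size_pair_poly size_XsubC => /(_ isT).
Qed.

Lemma pair_poly_i : pair_poly ('i%C : R[i]) = 'X^2 + 1.
Proof. by rewrite /pair_poly /= subr0 expr1n. Qed.

(** Substituting (X - Re z) / Im z in X^2 + 1 gives [pair_poly z] divided by (Im z)^2. *)
Lemma pair_poly_shift z : complex.Im z != 0 ->
  pair_poly z %= pair_poly 'i%C \Po
    ((complex.Im z)^-1 *: 'X + (- (complex.Im z)^-1 * complex.Re z)%:P).
Proof.
case: z => a b /= b0; rewrite pair_poly_i /pair_poly /=.
have -> : ('X - a%:P) ^+ 2 + (b ^+ 2)%:P =
    b ^+ 2 *: (('X^2 + 1) \Po (b^-1 *: 'X + (- b^-1 * a)%:P)).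
  have -> : b^-1 *: 'X + (- b^-1 * a)%:P = b^-1 *: ('X - a%:P).
    by rewrite -!mul_polyC mulNr !rmorphN rmorphM /=; ring.
  rewrite comp_polyD comp_polyC comp_Xn_poly exprZn scalerDr scalerA.
  by rewrite -exprMn divff // expr1n scale1r alg_polyC.
by rewrite eqp_scale // expf_neq0.
Qed.

(** Evaluation at the imaginary unit identifies R[X]/(X^2 + 1) with the complex numbers; the four
    coordinates are the real and imaginary parts of the two values. *)
Lemma poly_presented_affC : poly_presented (affC R) (pair_poly 'i%C).
Proof.
pose ev (p : {poly R}) : R[i] := (map_poly (real_complex R) p).['i%C].
have evD p q : ev (p + q) = ev p + ev q by rewrite /ev rmorphD hornerD.
have evB p q : ev (p - q) = ev p - ev q by rewrite /ev rmorphB hornerD hornerN.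
have evM p q : ev (p * q) = ev p * ev q by rewrite /ev rmorphM hornerM.
have evC c : ev c%:P = c%:C%C by rewrite /ev map_polyC hornerC.
have ev0 : ev 0 = 0 by rewrite /ev rmorph0 horner0.
have evX : ev 'X = 'i%C by rewrite /ev map_polyX hornerX.
pose G0 (pu : {poly R} * {poly R}) : affC R :=
  \row_i nth 0 [:: complex.Re (ev pu.1); complex.Im (ev pu.1);
                   complex.Re (ev pu.2); complex.Im (ev pu.2)] i.
have Glin : linear G0.
  move=> c x y; apply/rowP=> i; rewrite !mxE /= -!mul_polyC !evD !evM !evC.
  move: (ev x.1) (ev x.2) (ev y.1) (ev y.2) => [a1 a2] [b1 b2] [c1 c2] [d1 d2].
  by case: i => [[|[|[|[|//]]]] ilt] /=; ring.
pose G : {linear ({poly R} * {poly R})%type -> affC R} :=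
  HB.pack G0 (GRing.isLinear.Build R _ (affC R) *:%R G0 Glin).
have evC2 a b : ev (a%:P + b%:P * 'X) = Complex a b.
  by rewrite evD evM !evC evX; simpc.
exists G; split=> [x | pu | pu qw] /=.
- exists ((x 0 0)%:P + (x 0 1)%:P * 'X, (x 0 2)%:P + (x 0 3)%:P * 'X).
  apply/eqP/rowP => i; rewrite mxE /= !evC2 /=.
  by case: i => [[|[|[|[|//]]]] ilt] /=; congr (x _ _); apply: val_inj.
- rewrite !pair_poly_dvd /= ?oner_eq0 // !/(root _ _) -!/(ev _).
  apply/eqP/andP => [e | [/eqP e1 /eqP e2]].
    have h j := congr1 (fun x : 'rV_4 => x 0 j) e.
    move: (h 0) (h 1) (h 2) (h 3); rewrite !mxE /=.
    by case: (ev _) (ev _) => [a b] [c d] /= -> -> -> ->.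
  by apply/rowP => i; rewrite !mxE e1 e2; case: i => [[|[|[|[|//]]]] ilt].
apply/rowP => i; rewrite /lie_bracket /= /affC_bracket /wedge !mxE /= evB !evM.
rewrite ev0.
move: (ev pu.1) (ev pu.2) (ev qw.1) (ev qw.2) => [a1 a2] [b1 b2] [c1 c2] [d1 d2].
by case: i => [[|[|[|[|//]]]] ilt] /=; ring.
Qed.

(** The last basis vector is cyclic. As [n] and [t] commute, (X^2 + 1)^i acts as t^i n^i; n^m kills
    e_{2m}, while n^{m-1} sends it to e_2, in the kernel of [n], where [t] is injective. *)
Lemma poly_presented_D01 m :
  poly_presented (D01 R (2 * m)%N) (pair_poly 'i%C ^+ m).
Proof.
set phi := mx_end (M01 R (2 * m)%N).
pose s := M01s R (2 * m)%N; pose n := M01n R (2 * m)%N.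
pose e := basis_cV R (2 * m)%N.
pose t := 2%:R *: s + n.
have sn : s *m n = n *m s := M01s_nC R m.
have ss : s *m s = - 1%:M := M01s_sqr R m.
(* (s + n)^2 + 1 = n (2 s + n), because s^2 = -1. *)
have quad x : horner_lfun phi (pair_poly 'i%C) x = n *m (t *m x).
  rewrite pair_poly_i linearD /= horner_lfunXn -polyC1 horner_lfunC scale1r.
  rewrite add_lfunE /= comp_lfun1r comp_lfunE id_lfunE !mx_endE !mulmxA.
  rewrite -[X in _ + X]mul1mx.
  rewrite -mulmxDl; congr (_ *m _).
  rewrite /t /M01 -/s -/n mulmxDl !mulmxDr ss sn -scalemxAr scaler_nat mulr2n.
  by rewrite addrC !addrA subrr add0r.
have nt : n *m t = t *m n.
  by rewrite /t mulmxDr mulmxDl -scalemxAr -scalemxAl sn.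
have niter i x : n *m iter i (mulmx t) x = iter i (mulmx t) (n *m x).
  by elim: i => //= i IHi; rewrite mulmxA nt -mulmxA IHi.
have quadX i x : horner_lfun phi (pair_poly 'i%C ^+ i) x =
    iter i (mulmx t) (iter i (mulmx n) x).
  elim: i => [|i IHi].
    by rewrite expr0 -polyC1 horner_lfunC scale1r id_lfunE.
  by rewrite exprS horner_lfunMv IHi quad mulmxA nt -mulmxA niter.
have nX i : (i <= m)%N -> iter i (mulmx n) (e (2 * m)%N) = e (2 * (m - i))%N.
  elim: i => [|i IHi] im /=; first by rewrite subn0.
  rewrite IHi; last exact: ltnW.
  by rewrite -(subnSK im) mulnS M01n_basis //; lia.
(* On the kernel of [n], [t] is [2 s]: it is injective because [s] squares to -1, and preserves this
   kernel because [s] and [n] commute. *)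
have tX i x : x != 0 -> n *m x = 0 -> iter i (mulmx t) x != 0.
  elim: i x => // i IHi x x0 nx; rewrite iterSr mulmxDl nx addr0 -scalemxAl.
  have sx0 : s *m x != 0.
    apply: contraNneq x0 => sx; rewrite -oppr_eq0.
    have -> : - x = s *m (s *m x) by rewrite mulmxA ss mulNmx mul1mx.
    by rewrite sx mulmx0.
  apply: IHi; first by rewrite scaler_eq0 negb_or pnatr_eq0.
  by rewrite -scalemxAr mulmxA -sn -mulmxA nx mulmx0 scaler0.
apply: (@poly_presented_G_alg _ _ _ (e (2 * m)%N)); last first.
  by rewrite size_pair_poly_exp dim_cV.
(* For m = 0 the space is zero and the order is 1; [is_order_irreducible] needs a positive
   exponent. *)
have [m0|m0] := posnP m.
  have -> : e (2 * m)%N = 0 by apply/colP => a; have := ltn_ord a; lia.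
  by rewrite m0 => p; rewrite linear0 eqxx expr0 dvd1p.
suff: is_order phi (e (2 * m)%N) (pair_poly 'i%C ^+ m.-1.+1) by rewrite prednK.
apply: is_order_irreducible.
- by apply: pair_poly_irreducible; rewrite oner_eq0.
- rewrite quadX nX prednK // subnn [e _]basis_cV0.
  have t0 i : iter i (mulmx t) (0 : 'cV[R]_(2 * m)%N) = 0.
    by elim: i => //= i ->; exact: mulmx0.
  by rewrite t0.
rewrite quadX nX ?leq_pred //; have -> : (m - m.-1 = 1)%N by lia.
rewrite tX ?basis_cV_neq0 //; first by lia.
by rewrite M01n_basis ?basis_cV0 //; lia.
Qed.

End PairPoly.

Lemma size_prod_pred (K : fieldType) (I : finType) (F : I -> {poly K})
    (d : I -> nat) :
  (forall i, size (F i) = (d i).+1) -> size (\prod_i F i) = (\sum_i d i).+1.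
Proof.
move=> sz; rewrite size_prod => [|i _]; last by rewrite -size_poly_gt0 sz.
under eq_bigr do rewrite sz -addn1.
by rewrite big_split /= sum1_card -addSn addnK.
Qed.

(** * Arbitrary conjugate pairs, and eigenvalues as roots *)

Section Real.
Variable R : realType.

Lemma poly_presented_affC_pair (z : R[i]) : complex.Im z != 0 ->
  poly_presented (affC R) (pair_poly z).
Proof.
move=> im.
apply: poly_presented_eqp (poly_presented_comp _ _ (poly_presented_affC R)).
  by rewrite eqp_sym; apply: pair_poly_shift.
by rewrite invr_eq0.
Qed.

Lemma poly_presented_D01_pair (z : R[i]) m : complex.Im z != 0 ->
  poly_presented (D01 R (2 * m)%N) (pair_poly z ^+ m).
Proof.
move=> im.
apply: poly_presented_eqp (poly_presented_comp _ _ (poly_presented_D01 R m)).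
  by rewrite rmorphXn /= eqp_sym; apply: eqp_exp; apply: pair_poly_shift.
by rewrite invr_eq0.
Qed.

Variables (V : vectType R) (phi : 'End(V)).

Lemma leigenvalue_root x :
  passmx.leigenvalue phi x -> root (lfun_char_poly phi) x.
Proof.
rewrite /passmx.leigenvalue (passmx.leigenspaceE (vbasisP fullv)) => nz.
rewrite -eigenvalue_root_char /eigenvalue; apply: contraNneq nz => /= ->.
by rewrite passmx.vsof_eq0 ?vbasisP.
Qed.

Lemma complex_eigenvalue_root z : complex_eigenvalue phi z =
  root (map_poly (real_complex R) (lfun_char_poly phi)) z.
Proof. by rewrite /complex_eigenvalue eigenvalue_root_char map_char_poly. Qed.

End Real.

(** * Factorization of the characteristic polynomial and assembly of the summands *)

Theorem theorem4 (R : realType) (V : vectType R) (n : nat) (phi : 'End(V))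
    (p q : nat) (lambda : 'I_p -> R) (k : 'I_p -> nat)
    (z : 'I_q -> R[i]) (m : 'I_q -> nat) :
  \dim {:V} = n ->
  nonderogatory phi ->
  injective lambda ->
  (forall x, passmx.leigenvalue phi x <-> exists j, x = lambda j) ->
  (forall j, k j = eigen_mult phi (lambda j)) ->
  injective z ->
  (forall l l', z l <> conjc (z l')) ->
  (forall w, complex_eigenvalue phi w /\ complex.Im w <> 0 <->
     exists l, w = z l \/ w = conjc (z l)) ->
  (forall l, is_pair_mult phi (z l) (m l)) ->
  n = (\sum_(j < p) k j + 2 * \sum_(l < q) m l)%N ->
  [/\ lie_isomorphic (G_alg phi)
        (lie_pair (lie_dsum (fun j : 'I_p => D0 R (k j)))
                  (lie_dsum (fun l : 'I_q => D01 R (2 * m l)%N))),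
      p = n ->
        lie_isomorphic (G_alg phi) (lie_dsum (fun _ : 'I_n => affR R)),
      p = 1%N -> q = 0%N -> lie_isomorphic (G_alg phi) (D0 R n),
      (2 * q)%N = n ->
        lie_isomorphic (G_alg phi) (lie_dsum (fun _ : 'I_(n./2) => affC R))
    & p = 0%N -> q = 1%N -> lie_isomorphic (G_alg phi) (D01 R n)].
Proof.
move=> dimV nd lam_inj lam_eig kE z_inj z_conj z_eig mE nE.
pose chi := lfun_char_poly phi.
have chi0 : chi != 0 by case: nd => mon _ _; apply: monic_neq0.
have chi_size : size chi = n.+1 by rewrite size_char_poly dimV.
(* A real [z l] would be its own conjugate, against [z_conj l l]. *)
have imz l : complex.Im (z l) != 0.
  apply/eqP => im; apply: (z_conj l l).
  by case: (z l) im => a b /= ->; rewrite oppr0.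
pose f (i : 'I_p + 'I_q) :=
  match i with inl j => 'X - (lambda j)%:P | inr l => pair_poly (z l) end.
pose e (i : 'I_p + 'I_q) := match i with inl j => k j | inr l => m l end.
have f_irr i : irreducible_poly (f i).
  by case: i => [j|l]; [apply: irredp_XsubC | apply: pair_poly_irreducible].
have f_cop i i' : i != i' -> coprimep (f i) (f i').
  case: i i' => [j|l] [j'|l'] /= ne.
  - rewrite coprimep_XsubC root_XsubC; apply: contraNneq ne => /lam_inj ->.
    exact: eqxx.
  - by rewrite coprimep_sym pair_poly_XsubC_coprime.
  - exact: pair_poly_XsubC_coprime.
  apply: pair_poly_coprime => //; last exact/eqP.
  by apply: contraNneq ne => /z_inj ->.
have fe_cop i i' : i != i' -> coprimep (f i ^+ e i) (f i' ^+ e i').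
  by move=> ne; rewrite coprimep_expl // coprimep_expr // f_cop.
pose A := \prod_j ('X - (lambda j)%:P) ^+ k j.
pose B := \prod_l pair_poly (z l) ^+ m l.
have AB : \prod_i f i ^+ e i = A * B by rewrite big_sumType.
(* The coprime prime powers all divide [chi], hence so does their product; by [nE] the degrees
   agree. *)
have chiAB : chi %= A * B.
  rewrite eqp_sym -dvdp_size_eqp -AB.
    pose d (i : 'I_p + 'I_q) := match i with inl j => k j | inr l => 2 * m l end%N.
    rewrite (@size_prod_pred _ _ _ d).
      by rewrite big_sumType /= chi_size nE big_distrr.
    by case=> [j|l]; rewrite ?size_exp_XsubC ?size_pair_poly_exp.
  rewrite dvdp_prod_coprime //; apply/forallP => -[j|l] /=.
    by rewrite -mup_geq // kE.
  by case: (mE l).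
have GP : poly_presented (G_alg phi) chi.
  have [|v vP] := @min_poly_cyclic _ V _ phi f e chi nd f_irr f_cop.
    by rewrite AB.
  by apply: poly_presented_G_alg vP _; rewrite chi_size dimV.
have iso (L : lieAlgType R) mu : chi %= mu -> poly_presented L mu ->
    lie_isomorphic (G_alg phi) L.
  by move=> cm; apply: poly_presented_iso; apply: poly_presented_eqp GP.
have A_cop j j' : j != j' ->
    coprimep (('X - (lambda j)%:P) ^+ k j) (('X - (lambda j')%:P) ^+ k j').
  by move=> ne; apply: (fe_cop (inl j) (inl j')).
have B_cop l l' : l != l' ->
    coprimep (pair_poly (z l) ^+ m l) (pair_poly (z l') ^+ m l').
  by move=> ne; apply: (fe_cop (inr l) (inr l')).
have sum0 r (d : 'I_r -> nat) : (\sum_i d i)%N = 0%N -> forall i, d i = 0%N.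
  by move=> /eqP; rewrite sum_nat_eq0 => /forallP d0 i; apply/eqP/d0.
(* In (a) and (c) the number of eigenvalues is maximal, which forces their multiplicities to be
   1. *)
have sum_ge r (d : 'I_r -> nat) : (forall i, 0 < d i)%N ->
    (r <= \sum_i d i)%N /\
    ((\sum_i d i <= r)%N -> forall i, d i = 1%N).
  move=> d0; have E : (\sum_i d i = r + \sum_i (d i).-1)%N.
    rewrite -[X in (X + _)%N]card_ord -sum1_card -big_split /=.
    by apply: eq_bigr => i _; rewrite add1n prednK.
  split=> [|le i]; first by rewrite E leq_addr.
  have := d0 i; have /(_ i) : forall i, (d i).-1 = 0%N by apply: sum0; lia.
  by lia.
(* The two sums become opaque variables, as atoms for [lia]. *)
have [Sk SkE] : exists Sk, Sk = (\sum_j k j)%N by eexists.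
have [Sm SmE] : exists Sm, Sm = (\sum_l m l)%N by eexists.
rewrite -SkE -SmE in nE.
split.
- apply: iso chiAB _; apply: poly_presented_pair.
  + apply: coprimep_prodr => l _; rewrite coprimep_sym.
    apply: coprimep_prodr => j _; exact: (fe_cop (inr l) (inl j)).
  + by apply: poly_presented_dsum => // j; apply: poly_presented_D0_XsubC.
  by apply: poly_presented_dsum => // l; apply: poly_presented_D01_pair.
- move=> pn.
  (* Positive [k j] already exhaust the degree n = p, so every [k j] is 1, every [m l] is 0, and [B]
     is 1. *)
  have k0 j : (0 < k j)%N.
    rewrite kE /eigen_mult -XsubC_dvd // dvdp_XsubCl; apply: leigenvalue_root.
    by apply/lam_eig; exists j.
  have [] := sum_ge _ _ k0; rewrite -SkE => pk k1.
  have m0 : forall l, m l = 0%N by apply: sum0; rewrite -SmE; lia.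
  have {}k1 j : k j = 1%N by apply: k1; lia.
  rewrite -pn; apply: (iso _ (\prod_j ('X - (lambda j)%:P))).
    have B1 : B = 1 by apply: big1 => l _; rewrite m0 expr0.
    rewrite B1 mulr1 /A in chiAB; apply: eqp_trans chiAB _.
    under eq_bigr do rewrite k1 expr1.
    exact: eqpxx.
  apply: (@poly_presented_dsum _ _ (fun=> affR R)) => [j j' /A_cop | j].
    by rewrite !k1 !expr1.
  exact: poly_presented_affR_XsubC.
- move=> p1 q0; subst p q; apply: iso chiAB _.
  rewrite nE SkE SmE /A /B !big_ord0 mulr1 !big_ord1 addn0.
  exact: poly_presented_D0_XsubC.
- move=> qn; have -> : n./2 = q by lia.
  (* [z l] is a root of [chi], so [pair_poly z] divides it at least once, and [m l] is the largest
     exponent. *)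
  have m0 l : (0 < m l)%N.
    have /z_eig[zl _] : exists l', z l = z l' \/ z l = conjc (z l').
      by exists l; left.
    have [_ /(_ 1%N)] := mE l; rewrite expr1 pair_poly_dvd //.
    by rewrite -complex_eigenvalue_root => /(_ zl).
  have [] := sum_ge _ _ m0; rewrite -SmE => qm m1.
  have k0 : forall j, k j = 0%N by apply: sum0; rewrite -SkE; lia.
  have {}m1 l : m l = 1%N by apply: m1; lia.
  apply: (iso _ (\prod_l pair_poly (z l))).
    have A1 : A = 1 by apply: big1 => j _; rewrite k0 expr0.
    rewrite A1 mul1r /B in chiAB; apply: eqp_trans chiAB _.
    under eq_bigr do rewrite m1 expr1.
    exact: eqpxx.
  apply: (@poly_presented_dsum _ _ (fun=> affC R)) => [l l' /B_cop | l].
    by rewrite !m1 !expr1.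
  exact: poly_presented_affC_pair.
move=> p0 q1; subst p q; apply: iso chiAB _.
rewrite nE SkE SmE /A /B !big_ord0 mul1r !big_ord1 add0n.
exact: poly_presented_D01_pair.
Qed.
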